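(* Let $\mathcal A$ be a unital $*$-algebra over $\mathbb C$ equipped with a vector space norm $\Vert\cdot\Vert_{\mathcal A}$, let $\mathcal V\subseteq\mathcal A$ be a finite-dimensional linear subspace with basis $\underline v=(v_1,\ldots,v_d)$, let $a\in\sum\mathcal V^2$ and let $\varepsilon>0$. Then the $\varepsilon$-ball $\{b\in\mathcal A\mid \Vert a-b\Vert_{\mathcal A}\leqslant\varepsilon\}$ around $a$ contains a sum of at most $$\min_{1<p\leqslant\infty}\left(\frac{\Vert G_{\underline v}\Vert_{p\to\mathcal A}\cdot\Vert a\Vert_{\underline v,\mathrm{sos}}}{\varepsilon}\right)^{\frac{p}{p-1}}$$ many Hermitian squares $w^*w$ of elements $w\in\mathcal V$, where for $p=\infty$ the exponent $\frac{\infty}{\infty-1}$ is read as $1$.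
   Context: The norm $\Vert\cdot\Vert_{\mathcal A}$ is an arbitrary vector space norm (no submultiplicativity or compatibility with $*$ is assumed). The set of sums of Hermitian squares of elements of $\mathcal V$ is $\sum\mathcal V^2=\{\sum_{k=1}^m w_k^*w_k\mid m\in\mathbb N,\ w_k\in\mathcal V\}$; the empty sum (zero squares) equals $0$. $\mathrm{Mat}_d(\mathbb C)$ is the space of complex $d\times d$ matrices and $\mathrm{Psd}_d(\mathbb C)$ the cone of (Hermitian) positive semidefinite matrices in it. The Gram map associated with $\underline v$ is the linear map $G_{\underline v}\colon\mathrm{Mat}_d(\mathbb C)\to\mathcal A$, $G_{\underline v}(M)=\sum_{i,j=1}^d m_{ij}v_i^*v_j$ for $M=(m_{ij})_{i,j}$. One has $G_{\underline v}(\mathrm{Psd}_d(\mathbb C))=\sum\mathcal V^2$. For $1\leqslant p<\infty$ the Schatten $p$-norm is $\Vert M\Vert_p=(\mathrm{tr}(\sqrt{M^*M}^{\,p}))^{1/p}$, and $\Vert M\Vert_\infty$ is the largest singular value of $M$. The operator norm $\Vert G_{\underline v}\Vert_{p\to\mathcal A}$ is the smallest constant $C$ with $\Vert G_{\underline v}(M)\Vert_{\mathcal A}\leqslant C\Vert M\Vert_p$ for all $M\in\mathrm{Mat}_d(\mathbb C)$. For $a\in\sum\mathcal V^2$ the sos-norm is $\Vert a\Vert_{\underline v,\mathrm{sos}}=\min\{\mathrm{tr}(M)\mid M\in\mathrm{Psd}_d(\mathbb C),\ G_{\underline v}(M)=a\}$. The minimum over $1<p\leqslant\infty$ is understood as an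 infimum in case it is not attained. *)

(* Defs.v *)
(* MathComp + MathComp-Analysis; the complex numbers are R[i] with R : realType. *)
From HB Require Import structures.
From mathcomp Require Import all_boot all_order all_algebra.
From mathcomp Require Import complex.
From mathcomp Require Import all_classical all_reals all_analysis.

Set Implicit Arguments.
Unset Strict Implicit.
Unset Printing Implicit Defensive.

Import Order.TTheory GRing.Theory Num.Theory.
Local Open Scope classical_set_scope.
Local Open Scope ring_scope.
Local Open Scope complex_scope.
Local Open Scope sesquilinear_scope.

(* A *-algebra: an algebra with a conjugate-linear involution that reverses
   products.  algType provides the unit; its only extra requirement is that
   1 != 0, i.e. that the algebra is not the zero algebra. *)
HB.mixin Record hasStar (R : rcfType) A of GRing.Algebra R[i] A := {
  star : A -> A;
  starK : forall x : A, star (star x) = x;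
  starD : forall x y : A, star (x + y) = star x + star y;
  starZ : forall (c : R[i]) (x : A), star (c *: x) = Num.conj c *: star x;
  starM : forall x y : A, star (x * y) = star y * star x
}.

#[short(type="starAlgType")]
HB.structure Definition StarAlgebra (R : rcfType) :=
  {A of GRing.Algebra R[i] A & hasStar R A}.

Section VectorSpaces.
Variables (R : realType) (A : lmodType R[i]).

(* complex.Re `|c| is the modulus of c as an element of R. *)
Record is_vector_norm (nrm : A -> R) : Prop := IsVectorNorm {
  vnorm_ge0 : forall x, 0 <= nrm x;
  vnorm_eq0 : forall x, nrm x = 0 -> x = 0;
  vnormZ : forall (c : R[i]) x, nrm (c *: x) = complex.Re `|c| * nrm x;
  vnormD : forall x y, nrm (x + y) <= nrm x + nrm y
}.

(* The ambient space may be infinite-dimensional, so vector.v does not apply. *)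
Definition is_basis (V : {pred A}) (d : nat) (v : 'I_d -> A) : Prop :=
  [/\ forall i, v i \in V,
      forall c : 'I_d -> R[i], \sum_i c i *: v i = 0 -> forall i, c i = 0 &
      forall x, x \in V -> exists c : 'I_d -> R[i], x = \sum_i c i *: v i].

End VectorSpaces.

Section Matrices.
Variables (R : realType) (d : nat).
Implicit Types M H : 'M[R[i]]_d.

(* 0 <= z in R[i] means that z is real and nonnegative. *)
Definition psdmx M : Prop :=
  M \is hermsymmx /\ forall x : 'cV[R[i]]_d, 0 <= (x^t* *m M *m x) 0 0.

(* Functional calculus f(H) for a Hermitian H, whose eigenvalues are real. *)
Definition hermfun (f : R -> R) H : 'M[R[i]]_d :=
  invmx (spectralmx H)
    *m diag_mx (map_mx (fun z : R[i] => (f (complex.Re z))%:C) (spectral_diag H))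
    *m spectralmx H.

Definition absmx M : 'M[R[i]]_d := hermfun (@Num.sqrt R) (M^t* *m M).

Definition singular_value M (i : 'I_d) : R :=
  Num.sqrt (complex.Re (spectral_diag (M^t* *m M) 0 i)).

(* Only used for 1 <= p; the value at -oo is junk.  The maximum starts at 0,
   which matters only when d = 0, where the norm is 0. *)
Definition schatten (p : \bar R) M : R :=
  match p with
  | r%:E => complex.Re (\tr (hermfun (fun t => t `^ r) (absmx M))) `^ r^-1
  | +oo%E => \big[Num.max/0]_(i < d) singular_value M i
  | -oo%E => 0
  end.

End Matrices.

Section SumsOfSquares.
Variables (R : realType) (A : starAlgType R).

Definition is_sos (V : {pred A}) (a : A) : Prop :=
  exists (m : nat) (w : 'I_m -> A),
    (forall k, w k \in V) /\ a = \sum_(k < m) star (w k) * w k.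

Variables (d : nat) (v : 'I_d -> A).

Definition gram (M : 'M[R[i]]_d) : A :=
  \sum_(i < d) \sum_(j < d) M i j *: (star (v i) * v j).

(* The condition 0 <= C matters only when d = 0, where every C satisfies the
   inequality; the norm is then 0. *)
Definition gram_norm (nrm : A -> R) (p : \bar R) : R :=
  inf [set C : R | 0 <= C /\
         forall M : 'M[R[i]]_d, nrm (gram M) <= C * schatten p M].

(* The trace of a psd matrix is real, so Re only changes the type. *)
Definition sos_norm (a : A) : R :=
  inf [set complex.Re (\tr M) | M in [set M : 'M[R[i]]_d |
                                       psdmx M /\ gram M = a]].

End SumsOfSquares.

(* p / (p - 1), read as 1 at p = +oo; the value at -oo is junk. *)
Definition conj_exponent (R : realType) (p : \bar R) : R :=
  match p with
  | r%:E => r / (r - 1)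
  | +oo%E => 1
  | -oo%E => 0
  end.

Definition sos_bound (R : realType) (A : starAlgType R) (nrm : A -> R)
    (d : nat) (v : 'I_d -> A) (a : A) (eps : R) (p : \bar R) : R :=
  (gram_norm v nrm p * sos_norm v a / eps) `^ conj_exponent p.

(* Main.v *)
(* Write a psd Gram matrix of a with trace t close to the sos-norm as
   M = U^* diag(l) U, and discard from it the eigenvalues l_i <= t / (m + 1).
   By Markov's inequality at most m eigenvalues survive, and they give a sum of
   at most m squares.  The discarded part E satisfies
   ||E||_p <= t / (m + 1)^(1 - 1/p), since sum l_i^p <= max(l)^(p-1) sum l_i.
   Hence ||G(E)|| <= eps whenever m + 1 exceeds the bound at p (strictly, so
   that neither the infimum over p nor the sos-norm has to be attained), and m
   is the integer part of the infimum. *)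
Require Import Defs.
From HB Require Import structures.
From mathcomp Require Import all_boot all_order all_algebra.
From mathcomp Require Import complex.
From mathcomp Require Import all_classical all_reals all_analysis.

Set Implicit Arguments.
Unset Strict Implicit.
Unset Printing Implicit Defensive.

Import Order.TTheory GRing.Theory Num.Theory.
Local Open Scope classical_set_scope.
Local Open Scope ring_scope.

Lemma term_le_sum (R : numDomainType) (I : finType) (F : I -> R) (i : I) :
  (forall j, 0 <= F j) -> F i <= \sum_j F j.
Proof. by move=> F0; rewrite (bigD1 i)//= lerDl sumr_ge0. Qed.

Lemma sumr_sub_in (Z : zmodType) (I : finType) (S : {set I}) (F : I -> Z) :
  \sum_k F k - \sum_(k in S) F k = \sum_(k | k \notin S) F k.
Proof. by rewrite (bigID (mem S))/= addrAC subrr add0r. Qed.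

(** * Unitary diagonalizations and their dependence on the chosen eigenbasis *)

Section UnitaryDiagonalization.
Local Open Scope sesquilinear_scope.
Variables (C : numClosedFieldType) (d : nat).
Implicit Types (U V W : 'M[C]_d) (x y : 'rV[C]_d).

Definition udiag U x : 'M[C]_d := invmx U *m diag_mx x *m U.

Lemma adjmxM m n p (A : 'M[C]_(m, n)) (B : 'M[C]_(n, p)) :
  (A *m B)^t* = B^t* *m A^t*.
Proof. by rewrite trmx_mul map_mxM. Qed.

Lemma udiag_adj U x : U \is unitarymx ->
  (udiag U x)^t* = udiag U (map_mx Num.conj x).
Proof.
move=> Uu; rewrite /udiag invmx_unitary// !adjmxM trmxCK mulmxA.
by rewrite tr_diag_mx map_diag_mx.
Qed.

Lemma udiag_hermsym U x : U \is unitarymx -> x \is a mxOver Num.real ->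
  udiag U x \is hermsymmx.
Proof.
move=> Uu /mxOverP xr; rewrite is_hermitianmxE expr0 scale1r udiag_adj//.
suff -> : map_mx Num.conj x = x by [].
by apply/rowP => i; rewrite mxE; apply/CrealP.
Qed.

Lemma hermsym_udiag H : H \is hermsymmx ->
  H = udiag (spectralmx H) (spectral_diag H).
Proof. by move=> /hermitian_normalmx /orthomx_spectralP. Qed.

Lemma mxtrace_udiag U x : U \is unitarymx -> \tr (udiag U x) = \sum_i x 0 i.
Proof.
move=> /unitarymx_unit Uu.
by rewrite /udiag mxtrace_mulC mulmxA mulmxV// mul1mx mxtrace_diag.
Qed.

Lemma udiag_mul U x y : U \is unitarymx ->
  udiag U x *m udiag U y = udiag U (\row_i (x 0 i * y 0 i)).
Proof.
move=> /unitarymx_unit Uu; rewrite /udiag !mulmxA mulmxK//.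
by congr (_ *m _); rewrite -mulmxA mulmx_diag.
Qed.

Lemma udiag_sqr U x : U \is unitarymx -> x \is a mxOver Num.real ->
  (udiag U x)^t* *m udiag U x = udiag U (\row_i (x 0 i ^+ 2)).
Proof.
move=> Uu xr; have /is_hermitianmxP := udiag_hermsym Uu xr.
by rewrite expr0 scale1r => <-; rewrite udiag_mul.
Qed.

Lemma udiag_factor U x : U \is unitarymx -> x \is a mxOver Num.real ->
  (diag_mx x *m U)^t* *m (diag_mx x *m U) = udiag U (\row_i (x 0 i ^+ 2)).
Proof.
move=> Uu /mxOverP xr; rewrite adjmxM tr_diag_mx map_diag_mx.
have -> : map_mx Num.conj x = x.
  by apply/rowP => i; rewrite mxE; apply/CrealP.
rewrite /udiag invmx_unitary// !mulmxA; congr (_ *m _).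
by rewrite -mulmxA mulmx_diag.
Qed.

Lemma diag_intertwine W x y :
  diag_mx x *m W = W *m diag_mx y <-> forall i j, (x 0 i - y 0 j) * W i j = 0.
Proof.
split=> [/matrixP E i j|E].
  move: (E i j); rewrite mul_diag_mx mul_mx_diag !mxE mulrBl.
  by rewrite [y _ _ * _]mulrC => ->; rewrite subrr.
apply/matrixP => i j; rewrite mul_diag_mx mul_mx_diag !mxE [RHS]mulrC.
by apply/eqP; rewrite -subr_eq0 -mulrBl E.
Qed.

(* Two diagonalizations of a matrix differ by an invertible W := U V^-1 with
   W i j = 0 unless x i = y j.  This avoids comparing multisets of eigenvalues
   through characteristic polynomials. *)
Lemma udiag_intertwine U V x y : U \is unitarymx -> V \is unitarymx ->
  udiag U x = udiag V y <->
  forall i j, (x 0 i - y 0 j) * (U *m invmx V) i j = 0.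
Proof.
move=> /unitarymx_unit Uu /unitarymx_unit Vu; rewrite -diag_intertwine.
split=> [/(congr1 (fun X => U *m X *m invmx V))|
         /(congr1 (fun X => invmx U *m X *m V))]; rewrite /udiag !mulmxA.
  by rewrite mulmxV// mul1mx mulmxK.
by rewrite mulVmx// mul1mx mulmxKV.
Qed.

(** Where [W i j] is nonzero, [x i = y j] and hence [f (x i) = f (y j)], so the intertwining
    criterion survives [f]. This makes functional calculus independent of the diagonalization. *)
Lemma udiag_map (f : C -> C) U V x y : U \is unitarymx -> V \is unitarymx ->
  udiag U x = udiag V y -> udiag U (map_mx f x) = udiag V (map_mx f y).
Proof.
move=> Uu Vu /(udiag_intertwine _ _ Uu Vu) E.
apply/udiag_intertwine => // i j; have /eqP := E i j.
rewrite [map_mx f x _ _]mxE [map_mx f y _ _]mxE mulf_eq0 subr_eq0.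
by case/orP => /eqP ->; rewrite ?mulr0// subrr mul0r.
Qed.

(** An invertible [W] has no zero row, so each [x i] must meet some [y j]. *)
Lemma udiag_eigen U V x y : U \is unitarymx -> V \is unitarymx ->
  udiag U x = udiag V y -> forall i, exists j, x 0 i = y 0 j.
Proof.
move=> Uu Vu /(udiag_intertwine _ _ Uu Vu) E i.
have Wu : (U *m invmx V) \in unitmx.
  by rewrite unitmx_mul unitmx_inv !unitarymx_unit.
have [[j /eqP jP]|N] := pselect (exists j, x 0 i == y 0 j); first by exists j.
have /matrixP/(_ i i) := mulmxV Wu; rewrite !mxE eqxx big1 => [/eqP|j _].
  by rewrite eq_sym oner_eq0.
have /eqP := E i j; rewrite mulf_eq0 subr_eq0 => /orP[xy|/eqP ->].
  by case: N; exists j.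
by rewrite mul0r.
Qed.

Lemma adjmx_mul_hermsym n (A : 'M[C]_(n, d)) : A^t* *m A \is hermsymmx.
Proof. by rewrite is_hermitianmxE expr0 scale1r adjmxM trmxCK. Qed.

(** The adjoint of row [i] of [U] is a unit eigenvector for [x i]; testing against it turns positive
    semidefiniteness into nonnegative eigenvalues. *)
Lemma udiag_quadform U x (i : 'I_d) : U \is unitarymx ->
  ((row i U)^t*^t* *m udiag U x *m (row i U)^t*) 0 0 = x 0 i.
Proof.
move=> Uu; have Uv := unitarymx_unit Uu; rewrite trmxCK.
have /matrixP/(_ i i) : U *m udiag U x *m U^t* = diag_mx x.
  by rewrite -invmx_unitary// /udiag !mulmxA mulmxV// mul1mx mulmxK.
rewrite [RHS]mxE eqxx mulr1n => <-; rewrite -row_mul [LHS]mxE [RHS]mxE.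
apply: eq_bigr => k _; congr (_ * _); first by rewrite [LHS]mxE.
by rewrite !mxE.
Qed.

Lemma adjmx_mul_psd n (A : 'M[C]_(n, d)) (v : 'cV[C]_d) :
  0 <= (v^t* *m (A^t* *m A) *m v) 0 0.
Proof.
rewrite -!mulmxA mulmxA -adjmxM mxE sumr_ge0// => i _.
by rewrite !mxE mulrC mul_conjC_ge0.
Qed.

Lemma mxtrace_adjmx_mul (A : 'M[C]_d) :
  \tr (A^t* *m A) = \sum_i \sum_j `|A i j| ^+ 2.
Proof.
rewrite exchange_big; apply: eq_bigr => j _; rewrite mxE.
by apply: eq_bigr => i _; rewrite !mxE mulrC normCK.
Qed.

End UnitaryDiagonalization.

(** * Schatten norms in terms of real spectra, and control of matrix entries by them *)

Section Schatten.
Local Open Scope complex_scope.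
Local Open Scope sesquilinear_scope.
Variables (R : realType) (d : nat).
Implicit Types (U M H : 'M[R[i]]_d) (l : 'I_d -> R).

Definition rdiag U l : 'M[R[i]]_d := udiag U (\row_i (l i)%:C).

Lemma Re_sum (I : Type) (r : seq I) (P : pred I) (F : I -> R[i]) :
  complex.Re (\sum_(i <- r | P i) F i) = \sum_(i <- r | P i) complex.Re (F i).
Proof. by elim/big_rec2: _ => // i y x _ <-; case: (F i) x => ? ? []. Qed.

Lemma rdiag_row_real l : (\row_i (l i)%:C : 'rV[R[i]]_d) \is a mxOver Num.real.
Proof. by apply/mxOverP => i j; rewrite mxE complex_real. Qed.

Lemma rdiag_hermsym U l : U \is unitarymx -> rdiag U l \is hermsymmx.
Proof. by move=> Uu; apply: udiag_hermsym => //; exact: rdiag_row_real. Qed.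

Lemma hermsym_rdiag H : H \is hermsymmx ->
  H = rdiag (spectralmx H) (fun i => complex.Re (spectral_diag H 0 i)).
Proof.
move=> Hh; rewrite {1}(hermsym_udiag Hh) /rdiag.
suff <- : spectral_diag H =
  \row_i (complex.Re (spectral_diag H 0 i))%:C by [].
apply/rowP => i; rewrite mxE RRe_real//.
by have /mxOverP := hermitian_spectral_diag_real Hh; apply.
Qed.

Lemma mxtrace_rdiag U l : U \is unitarymx ->
  complex.Re (\tr (rdiag U l)) = \sum_i l i.
Proof.
move=> Uu; rewrite mxtrace_udiag// Re_sum.
by apply: eq_bigr => i _; rewrite mxE.
Qed.

Lemma rdiag_sqr U l : U \is unitarymx ->
  (rdiag U l)^t* *m rdiag U l = rdiag U (fun i => l i ^+ 2).
Proof.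
move=> Uu; rewrite /rdiag [LHS](udiag_sqr Uu (rdiag_row_real l)).
by congr udiag; apply/rowP => i; rewrite !mxE rmorphXn.
Qed.

(** [hermfun] is defined through the eigenbasis that [spectralmx] selects; [udiag_map] transports it
    to the given [U]. *)
Lemma hermfun_rdiag f U l : U \is unitarymx ->
  hermfun f (rdiag U l) = rdiag U (f \o l).
Proof.
move=> Uu; have /hermsym_udiag/esym := rdiag_hermsym l Uu.
move/(udiag_map (fun z : R[i] => (f (complex.Re z))%:C)
        (spectral_unitarymx _) Uu).
rewrite /hermfun -/(udiag _ _) => ->; rewrite /rdiag; congr udiag.
by apply/rowP => i; rewrite !mxE.
Qed.

Lemma singular_value_ge0 M i : 0 <= singular_value M i.
Proof. exact: sqrtr_ge0. Qed.

Lemma schatten_finE r M :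
  schatten r%:E M = (\sum_i singular_value M i `^ r) `^ r^-1.
Proof.
have E := hermsym_rdiag (adjmx_mul_hermsym M).
have Su := spectral_unitarymx (M^t* *m M).
rewrite /schatten /absmx [in hermfun Num.sqrt _]E !hermfun_rdiag//.
by rewrite mxtrace_rdiag.
Qed.

Lemma schatten_fin_rdiag r U l : U \is unitarymx -> (forall i, 0 <= l i) ->
  schatten r%:E (rdiag U l) = (\sum_i l i `^ r) `^ r^-1.
Proof.
move=> Uu l0; rewrite /schatten /absmx (rdiag_sqr l Uu).
rewrite (hermfun_rdiag _ _ Uu) (hermfun_rdiag _ _ Uu) (mxtrace_rdiag _ Uu).
congr (_ `^ _); apply: eq_bigr => i _ /=.
by rewrite sqrtr_sqr ger0_norm.
Qed.

Lemma schatten_inf_rdiag_le c U l : U \is unitarymx ->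
  0 <= c -> (forall i, 0 <= l i <= c) -> schatten +oo%E (rdiag U l) <= c.
Proof.
move=> Uu c0 lc; apply: bigmax_le => // i _.
rewrite /singular_value rdiag_sqr//.
have /hermsym_udiag/esym := rdiag_hermsym (fun i => l i ^+ 2) Uu.
(* The order of [spectral_diag] is unknown, but its [i]-th entry is some [l j ^+ 2], which suffices
   to bound a maximum. *)
move/(udiag_eigen (spectral_unitarymx _) Uu)/(_ i) => [j ->].
have /andP[lj0 ljc] := lc j; rewrite mxE.
by rewrite [complex.Re _]/= sqrtr_sqr ger0_norm.
Qed.

Lemma singular_value_le_schatten p M i : (1 < p)%E ->
  singular_value M i <= schatten p M.
Proof.
case: p => [r| |]//; last by move=> _; exact: le_bigmax.
rewrite lte_fin => r1; have r0 : 0 < r by exact: lt_trans r1.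
rewrite schatten_finE -[leLHS]powRr1 ?singular_value_ge0//.
rewrite -(@mulfV _ r) ?gt_eqF// powRrM.
apply: ge0_ler_powR; rewrite ?nnegrE ?invr_ge0 ?powR_ge0 ?(ltW r0)//.
  by rewrite sumr_ge0// => j _; rewrite powR_ge0.
by apply: (term_le_sum (F := fun j => singular_value M j `^ r)) => j;
  rewrite powR_ge0.
Qed.

Lemma schatten_ge0 p M : (1 < p)%E -> 0 <= schatten p M.
Proof.
case: p => [r| |]// _; first exact: powR_ge0.
exact: bigmax_ge_id.
Qed.

(** Both sides are compared with the trace of [M^t* *m M], the squared Hilbert-Schmidt norm. *)
Lemma sum_sqr_norm_le M : \sum_i \sum_j complex.Re `|M i j| ^+ 2 <=
  \sum_i singular_value M i ^+ 2.
Proof.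
have E := hermsym_rdiag (adjmx_mul_hermsym M).
have Su := spectral_unitarymx (M^t* *m M).
have -> : \sum_i \sum_j complex.Re `|M i j| ^+ 2 =
    complex.Re (\tr (M^t* *m M)).
  rewrite mxtrace_adjmx_mul Re_sum; apply: eq_bigr => i _.
  by rewrite Re_sum; apply: eq_bigr => j _; rewrite normc_def -rmorphXn.
rewrite E mxtrace_rdiag//; apply: ler_sum => i _; rewrite /singular_value.
have [x0|x0] := leP 0 (complex.Re (spectral_diag (M^t* *m M) 0 i)).
  by rewrite sqr_sqrtr.
(* For a negative argument [Num.sqrt] is 0, whose square still dominates it. *)
by rewrite (le_trans (ltW x0))// sqr_ge0.
Qed.

Lemma entry_le_schatten p M i j : (1 < p)%E ->
  complex.Re `|M i j| <= d%:R * schatten p M.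
Proof.
move=> p1; have S0 := schatten_ge0 M p1.
have d1 : 1 <= d%:R :> R by rewrite ler1n (leq_trans _ (ltn_ord i)).
have N0 : 0 <= complex.Re `|M i j| by rewrite normc_def [leRHS]/= sqrtr_ge0.
rewrite -(@ler_pXn2r _ 2)// ?nnegrE ?mulr_ge0 ?ler0n//.
apply: (@le_trans _ _ (\sum_i singular_value M i ^+ 2)).
  apply: le_trans (sum_sqr_norm_le M).
  pose F k := \sum_j complex.Re `|M k j| ^+ 2.
  apply: (@le_trans _ _ (F i)).
    by apply: (term_le_sum (F := fun k => _) j) => k; exact: sqr_ge0.
  by apply: (term_le_sum (F := F) i) => k; apply: sumr_ge0 => *; exact: sqr_ge0.
apply: (@le_trans _ _ (\sum_(i < d) schatten p M ^+ 2)).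
  apply: ler_sum => k _.
  by rewrite ler_pXn2r ?nnegrE ?singular_value_ge0 ?singular_value_le_schatten.
(* The factor [d] is weakened to [d ^+ 2], which keeps square roots out of the constant. *)
rewrite sumr_const card_ord -[leLHS]mulr_natl exprMn ler_wpM2r ?sqr_ge0//.
by rewrite expr2 ler_peMr ?ler0n.
Qed.

Lemma psd_rdiag M : psdmx M ->
  exists U l, [/\ U \is unitarymx, forall i, 0 <= l i & M = rdiag U l].
Proof.
move=> [Mh Mp]; have E := hermsym_rdiag Mh.
have Uu := spectral_unitarymx M.
exists (spectralmx M), (fun i => complex.Re (spectral_diag M 0 i)).
split=> // i.
have := Mp ((row i (spectralmx M))^t*).
by rewrite {2}E udiag_quadform// mxE ler0c.
Qed.

End Schatten.

(** * Size of the discarded spectrum and number of retained eigenvalues *)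

Section Tail.
Variables (R : realType) (d : nat).

(** Applied with [k = m.+1] and [k * x = t]. Since the inverse of [conj_exponent p] is [1 - 1/p],
    the bound equals [k^(1/p) * x], and just [x] at [p = +oo]. *)
Lemma schatten_rdiag_le (U : 'M[R[i]]_d) (l : 'I_d -> R) (x k : R) p :
  U \is unitarymx -> (1 < p)%E -> 0 < k -> (forall i, 0 <= l i <= x) ->
  0 <= x -> \sum_i l i <= k * x ->
  schatten p (rdiag U l) <= k * x / k `^ (conj_exponent p)^-1.
Proof.
move=> Uu p1 k0 lx x0 lk; have l0 i : 0 <= l i by have /andP[] := lx i.
case: p p1 => [r| |]//; last first.
  move=> _; rewrite [conj_exponent _]/= invr1 powRr1 ?(ltW k0)//.
  rewrite mulrAC divff ?gt_eqF// mul1r.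
  exact: schatten_inf_rdiag_le.
rewrite lte_fin => r1; have r0 : 0 < r by exact: lt_trans r1.
rewrite schatten_fin_rdiag//= invf_div mulrBl divff ?gt_eqF// mul1r.
apply: (@le_trans _ _ ((k * x `^ r) `^ r^-1)).
  apply: ge0_ler_powR;
    rewrite ?nnegrE ?invr_ge0 ?mulr_ge0 ?powR_ge0 ?(ltW r0) ?(ltW k0)//.
    by rewrite sumr_ge0// => j _; rewrite powR_ge0.
  (* Splitting off one factor, [x^r = x * x^(r-1)] and likewise for [l i], leaves the linear sum to
     be bounded by [k * x]. *)
  rewrite -(mulr_powRB1 x0 r0) mulrA.
  apply: (@le_trans _ _ ((\sum_i l i) * x `^ (r - 1))); last first.
    by rewrite ler_wpM2r ?powR_ge0.
  rewrite mulr_suml; apply: ler_sum => i _; rewrite -(mulr_powRB1 (l0 i) r0).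
  have /andP[_ lix] := lx i.
  by rewrite ler_wpM2l// ge0_ler_powR ?nnegrE ?subr_ge0 ?(ltW r1).
rewrite powRM ?powR_ge0 ?(ltW k0)// -powRrM mulfV ?gt_eqF// powRr1//.
rewrite powRB; last by rewrite (gt_eqF k0) implybT.
rewrite powRr1 ?(ltW k0)// invf_div [leRHS]mulrC mulrA.
by rewrite -[k `^ r^-1 / k * k]mulrA mulVf ?gt_eqF ?mulr1.
Qed.

Lemma card_gt_le (l : 'I_d -> R) (x : R) (m : nat) : (forall i, 0 <= l i) ->
  \sum_i l i <= m.+1%:R * x -> 0 <= x -> (#|[set i | (x < l i)%R]%SET| <= m)%N.
Proof.
move=> l0 lx x0; rewrite leqNgt; apply/negP => mS; set S := finset _ in mS.
(* Strictness of the summed inequality requires at least one index in [S]. *)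
have [i iS] : exists i, i \in S by apply/card_gt0P; exact: leq_ltn_trans mS.
suff : \sum_i l i > m.+1%:R * x by rewrite ltNge lx.
apply: (@le_lt_trans _ _ (\sum_(i in S) x)).
  by rewrite sumr_const -[leRHS]mulr_natl ler_wpM2r// ler_nat.
apply: (@lt_le_trans _ _ (\sum_(i in S) l i)).
  apply: ltr_sum; first by apply/hasP; exists i; rewrite ?mem_index_enum.
  by move=> j; rewrite inE.
by rewrite [leRHS](bigID (mem S))/= lerDl sumr_ge0.
Qed.

End Tail.

(** * The Gram map, its operator norm, the sos-norm and truncation *)

Section Gram.
Local Open Scope complex_scope.
Local Open Scope sesquilinear_scope.
Variables (R : realType) (A : starAlgType R).

Lemma star_sum (I : Type) (r : seq I) (P : pred I) (F : I -> A) :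
  star (\sum_(i <- r | P i) F i) = \sum_(i <- r | P i) star (F i).
Proof.
have s0 : star (0 : A) = 0.
  by apply: (addrI (star (0 : A))); rewrite -starD !addr0.
by elim/big_rec2: _ => [//|i x y _ <-]; rewrite starD.
Qed.

Lemma vnorm_sum (nrm : A -> R) (nrmP : is_vector_norm nrm) (I : Type)
    (r : seq I) (P : pred I) (F : I -> A) :
  nrm (\sum_(i <- r | P i) F i) <= \sum_(i <- r | P i) nrm (F i).
Proof.
have n0 : nrm 0 = 0 by rewrite -(scale0r 0) (vnormZ nrmP) normr0 mul0r.
elim/big_rec2: _ => [|i x y _ le]; first by rewrite n0.
by rewrite (le_trans (vnormD nrmP _ _))// lerD2l.
Qed.

Variables (d : nat) (v : 'I_d -> A).

(** Row [k] of [B] holds the coordinates of [w k], so a factorization of the Gram matrix is the same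
    as a sum of squares. *)
Lemma gram_adjmx_mul n (B : 'M[R[i]]_(n, d)) (w : 'I_n -> A) :
  (forall k, w k = \sum_j B k j *: v j) ->
  gram v (B^t* *m B) = \sum_k star (w k) * w k.
Proof.
move=> wE; transitivity (\sum_i \sum_j \sum_k
    (Num.conj (B k i) * B k j) *: (star (v i) * v j)).
  apply: eq_bigr => i _; apply: eq_bigr => j _; rewrite mxE scaler_suml.
  by apply: eq_bigr => k _; rewrite !mxE.
under eq_bigr do rewrite exchange_big.
rewrite exchange_big; apply: eq_bigr => k _.
rewrite wE star_sum mulr_suml; apply: eq_bigr => i _.
rewrite mulr_sumr; apply: eq_bigr => j _.
by rewrite starZ -scalerAl -scalerAr scalerA.
Qed.

(** Factoring through [diag(sqrt l) U] yields one square per eigenvalue, which vanishes with it. *)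
Lemma gram_rdiag U l : U \is unitarymx -> (forall i, 0 <= l i) ->
  let w k := (Num.sqrt (l k))%:C *: \sum_j U k j *: v j in
  gram v (rdiag U l) = \sum_k star (w k) * w k.
Proof.
move=> Uu l0 w.
have <- : (diag_mx (\row_i (Num.sqrt (l i))%:C) *m U)^t* *m
    (diag_mx (\row_i (Num.sqrt (l i))%:C) *m U) = rdiag U l.
  rewrite (udiag_factor Uu (rdiag_row_real _)) /rdiag; congr udiag.
  by apply/rowP => i; rewrite !mxE -rmorphXn/= sqr_sqrtr.
apply: gram_adjmx_mul => k; rewrite /w scaler_sumr.
by apply: eq_bigr => j _; rewrite mul_diag_mx !mxE scalerA.
Qed.

(** Ensures that the infimum in [sos_norm] is over a nonempty set and not a default value. *)
Lemma psd_of_sos (V : {pred A}) a : is_basis V v -> is_sos V a ->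
  exists2 M : 'M[R[i]]_d, psdmx M & gram v M = a.
Proof.
move=> [_ _ span] [n [w [wV ->]]].
have /choice [c cE] : forall k, exists c : 'I_d -> R[i],
    w k = \sum_j c j *: v j by move=> k; exact: span.
pose B := \matrix_(k, j) c k j.
exists (B^t* *m B); last first.
  apply: gram_adjmx_mul => k; rewrite cE.
  by apply: eq_bigr => j _; rewrite mxE.
split; first exact: adjmx_mul_hermsym.
by move=> x; exact: adjmx_mul_psd.
Qed.

Variables (nrm : A -> R) (nrmP : is_vector_norm nrm).

(** Every entry of [M] is at most [d] times its Schatten norm. The resulting constant makes the set
    defining [gram_norm] nonempty. *)
Lemma gram_bounded : exists2 K : R, 0 <= K &
  forall p (M : 'M[R[i]]_d), (1 < p)%E -> nrm (gram v M) <= K * schatten p M.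
Proof.
pose c := \sum_i \sum_j nrm (star (v i) * v j).
have c0 : 0 <= c.
  by rewrite sumr_ge0// => i _; rewrite sumr_ge0// => j _; exact: vnorm_ge0.
exists (d%:R * c) => [|p M p1]; first by rewrite mulr_ge0.
rewrite mulrAC /c mulr_sumr.
apply: le_trans (vnorm_sum nrmP _ _ _) _; apply: ler_sum => i _.
rewrite mulr_sumr.
apply: le_trans (vnorm_sum nrmP _ _ _) _; apply: ler_sum => j _.
by rewrite (vnormZ nrmP) ler_wpM2r ?(vnorm_ge0 nrmP)// entry_le_schatten.
Qed.

Lemma gram_norm_ge0 p : (1 < p)%E -> 0 <= gram_norm v nrm p.
Proof.
move=> p1; have [K K0 KM] := gram_bounded.
apply: lb_le_inf; first by exists K; split=> // M; exact: KM.
by move=> C [].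
Qed.

Lemma gram_norm_le p (M : 'M[R[i]]_d) : (1 < p)%E ->
  nrm (gram v M) <= gram_norm v nrm p * schatten p M.
Proof.
move=> p1; have [K K0 KM] := gram_bounded.
(* Dividing by the Schatten norm turns the claim into a lower bound for the infimum; if that norm is
   0, the constant [K] already forces the left side to 0. *)
have := schatten_ge0 M p1; rewrite le_eqVlt => /predU1P[s0|s0].
  by have := KM p M p1; rewrite -s0 !mulr0.
rewrite -ler_pdivrMr//; apply: lb_le_inf.
  by exists K; split=> // N; exact: KM.
by move=> C [_ /(_ M)]; rewrite ler_pdivrMr.
Qed.

Lemma psd_trace_ge0 (M : 'M[R[i]]_d) : psdmx M -> 0 <= complex.Re (\tr M).
Proof.
by move=> /psd_rdiag[U [l [Uu l0 ->]]]; rewrite mxtrace_rdiag// sumr_ge0.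
Qed.

Lemma sos_norm_ge0 (V : {pred A}) a : is_basis V v -> is_sos V a ->
  0 <= sos_norm v a.
Proof.
move=> bV /(psd_of_sos bV)[M Mp Ma]; apply: lb_le_inf.
  by exists (complex.Re (\tr M)), M.
by move=> _ [N [Np _] <-]; exact: psd_trace_ge0.
Qed.

Lemma sos_norm_lt (V : {pred A}) a t : is_basis V v -> is_sos V a ->
  sos_norm v a < t ->
  exists M : 'M[R[i]]_d, [/\ psdmx M, gram v M = a & complex.Re (\tr M) < t].
Proof.
move=> bV /(psd_of_sos bV)[M Mp Ma] /inf_lt[|_ [N [Np Na] <-] Nt].
  by exists (complex.Re (\tr M)), M.
by exists N.
Qed.

Lemma gram_sparsify (V : {pred A}) a eps t p m :
  GRing.submod_closed V -> is_basis V v -> (1 < p)%E ->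
  (exists M : 'M[R[i]]_d,
    [/\ psdmx M, gram v M = a & complex.Re (\tr M) <= t]) ->
  gram_norm v nrm p * (t / m.+1%:R `^ (conj_exponent p)^-1) <= eps ->
  exists n (w : 'I_n -> A), [/\ (n <= m)%N, forall k, w k \in V
    & nrm (a - \sum_(k < n) star (w k) * w k) <= eps].
Proof.
move=> Vsub [vV _ _] p1 [M [/psd_rdiag[U [l [Uu l0 ->]]] <-]].
rewrite mxtrace_rdiag// => lt le_eps.
have m0 : 0 < m.+1%:R :> R by rewrite ltr0n.
have t0 : 0 <= t by rewrite (le_trans _ lt)// sumr_ge0.
pose x := t / m.+1%:R; have x0 : 0 <= x by rewrite divr_ge0.
have tE : t = m.+1%:R * x by rewrite /x mulrCA mulfV ?mulr1 ?gt_eqF.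
pose S := [set i | x < l i]%SET.
pose w k := (Num.sqrt (l k))%:C *: \sum_j U k j *: v j.
exists #|S|, (fun k => w (enum_val k)); split.
- by apply: card_gt_le => //; rewrite -tE.
- have [V0 VZ] := Vsub.
  (* Adding 0 gives the shape [c *: u + u'] under which [submod_closed] states closure. *)
  move=> k; rewrite -[w _]addr0; apply: (VZ) => //.
  by elim/big_rec: _ => // j u _ uV; exact: VZ.
pose l' i := if i \in S then 0 else l i.
have l'0 i : 0 <= l' i by rewrite /l'; case: ifP.
have l'x i : 0 <= l' i <= x.
  by rewrite l'0 /l'; case: ifPn => //=; rewrite inE -leNgt.
pose F k := star (w k) * w k.
have -> : \sum_(k < #|S|) F (enum_val k) = \sum_(k in S) F k.
  by rewrite [RHS]big_enum_val.
have -> : gram v (rdiag U l) - \sum_(k in S) F k = gram v (rdiag U l').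
  have gl : gram v (rdiag U l) = \sum_k F k by exact: gram_rdiag.
  (* With the same [U], the squares for [l'] agree with those for [l] off [S] and vanish on [S]. *)
  have gl' : gram v (rdiag U l') = \sum_k (if k \notin S then F k else 0).
    apply: etrans (gram_rdiag Uu l'0) _; apply: eq_bigr => k _; rewrite /l' /F.
    by case: (k \in S) => //=; rewrite sqrtr0 scale0r mulr0.
  apply: etrans (esym gl'); apply: etrans (congr1 (fun b => b - _) gl) _.
  by rewrite sumr_sub_in [LHS]big_mkcond.
apply: le_trans (gram_norm_le _ p1) (le_trans _ le_eps).
apply: ler_wpM2l; first exact: gram_norm_ge0.
rewrite tE; apply: schatten_rdiag_le => //; rewrite -tE.
apply: le_trans lt; apply: ler_sum => i _; rewrite /l'; by case: ifP.
Qed.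

End Gram.

Theorem theorem7 (R : realType) (A : starAlgType R)
    (nrm : A -> R) (nrm_norm : is_vector_norm nrm)
    (V : {pred A}) (V_subspace : GRing.submod_closed V)
    (d : nat) (v : 'I_d -> A) (v_basis : is_basis V v)
    (a : A) (a_sos : is_sos V a) (eps : R) (eps_gt0 : 0 < eps) :
  exists (m : nat) (w : 'I_m -> A),
    [/\ m%:R <= inf [set sos_bound nrm v a eps p | p in
                       [set p : \bar R | (1 < p)%E]],
        forall k, w k \in V
      & nrm (a - \sum_(k < m) star (w k) * w k) <= eps].
Proof.
set B := [set _ | _ in _].
have B0 : B !=set0.
  by exists (sos_bound nrm v a eps +oo%E); exists +oo%E => //=; rewrite ltry.
have b0 : 0 <= inf B by apply: lb_le_inf => // _ [p _ <-]; exact: powR_ge0.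
have /andP[mb bm] := truncn_itv b0.
(* As [inf B < m.+1], some single [p] has its bound strictly below [m.+1]; only this [p] is used
   from here on. *)
have [_ [p p1 <-] bp] := inf_lt B0 bm.
set m := Num.truncn (inf B) in mb bm bp.
suff [n [w [nm wV wa]]] : exists n (w : 'I_n -> A), [/\ (n <= m)%N,
    forall k, w k \in V & nrm (a - \sum_(k < n) star (w k) * w k) <= eps].
  by exists n, w; split=> //; rewrite (le_trans _ mb)// ler_nat.
set G := gram_norm v nrm p; set s := sos_norm v a.
have G0 : 0 <= G by exact: gram_norm_ge0.
have s0 : 0 <= s by exact: sos_norm_ge0 v_basis a_sos.
set q := conj_exponent p in bp *.
have q0 : 0 < q.
  rewrite /q; case: (p) p1 => [r| |]//=; rewrite lte_fin => r1.
  by rewrite divr_gt0 ?subr_gt0// (lt_trans _ r1).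
have k0 : 0 < m.+1%:R `^ q^-1 :> R by rewrite powR_gt0 ?ltr0n.
(* Taking [q]-th roots in [bp] preserves strictness. *)
have Gs : G * s < eps * m.+1%:R `^ q^-1.
  have x0 : 0 <= G * s / eps by rewrite !mulr_ge0// invr_ge0 (ltW eps_gt0).
  rewrite [ltRHS]mulrC -ltr_pdivrMr//.
  have -> : G * s / eps = ((G * s / eps) `^ q) `^ q^-1.
    by rewrite -powRrM mulfV ?powRr1// gt_eqF.
  by apply: gt0_ltr_powR; rewrite ?invr_gt0// nnegrE ?powR_ge0.
(* The strict inequality leaves room for a trace bound [t] above the sos-norm. For [G > 0] the
   largest such [t] is taken; for [G = 0] any [t > s] works. *)
have [t st Gt] : exists2 t, s < t & G * t <= eps * m.+1%:R `^ q^-1.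
  move: G0; rewrite le_eqVlt => /predU1P[<-|Gp].
    by exists (s + 1); rewrite ?ltrDl// mul0r ltW// mulr_gt0.
  exists (eps * m.+1%:R `^ q^-1 / G); first by rewrite ltr_pdivlMr// mulrC.
  by rewrite mulrC divfK ?gt_eqF.
apply: (@gram_sparsify _ _ _ v _ nrm_norm V a eps t p m) => //.
  have [M [Mp Ma /ltW Mt]] := sos_norm_lt v_basis a_sos st.
  by exists M.
by rewrite mulrA ler_pdivrMr.
Qed.
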